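(* There is an mcp (measure-class preserving) Borel action of the free group $\mathbb{F}_2$ of rank $2$ on a standard probability space that is essentially $1$-chaining but not boundedly chaining.
   Context: $\mathbb{N}$ includes $0$. A Borel action $\Gamma\curvearrowright(X,\mu)$ of a countable group on a standard probability space is mcp if for all Borel $A\subseteq X$ and $\gamma\in\Gamma$, $\mu(A)=0$ iff $\mu(\gamma A)=0$. For $k\in\mathbb{N}$, $A$ $k$-chains to $B$ if there are $\gamma_0=1_\Gamma,\gamma_1,\dots,\gamma_k\in\Gamma$ with $\mu(\gamma_iA\cap\gamma_{i+1}A)>0$ for each $0\le i<k$ and $\mu(\gamma_kA\cap B)>0$. The action is $k$-chaining if $A$ $k$-chains to $B$ for all sets $A,B\subseteq X$ of positive measure, and boundedly chaining if it is $k$-chaining for some $k\in\mathbb{N}$. It is $k$-chaining on a measurable set $W\subseteq X$ if $A$ $k$-chains to $B$ for all positive measure sets $A,B\subseteq W$ (the translates in the chain need not be contained in or meet $W$). It is essentially $k$-chaining if it is $k$-chaining on some measurable $W\subseteq X$ such that $\bigcup_{\gamma\in\Gamma}\gamma W$ is conull and $\{\gamma\in\Gamma:\mu(\gamma W\cap W)>0\}$ generates $\Gamma$. *)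

(* Defs.v *)
From HB Require Import structures.
From mathcomp Require Import all_boot all_order all_algebra.
From mathcomp Require Import all_classical all_reals all_analysis.

Set Implicit Arguments.
Unset Strict Implicit.
Unset Printing Implicit Defensive.

Local Open Scope classical_set_scope.

(* A letter (a, true) stands for the generator a and (a, false) for its
   inverse; the elements of the free group on T are the reduced words. *)
Section FreeGroup.
Variable T : choiceType.
Implicit Types (l : T * bool) (s t : seq (T * bool)).

Definition inv_letter l := (l.1, ~~ l.2).

Definition reduced s := sorted (fun l l' => l' != inv_letter l) s.

Record free_group := FreeGroup { word : seq (T * bool); _ : reduced word }.

HB.instance Definition _ := [isSub for word].
HB.instance Definition _ := [Choice of free_group by <:].

Definition cons_red l s :=
  if s is l' :: s' then if l' == inv_letter l then s' else l :: s else [:: l].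

(* When s and t are reduced, cat_red s t is the reduced form of s ++ t. *)
Definition cat_red s t := foldr cons_red t s.

Definition inv_word s := rev (map inv_letter s).

Lemma inv_letterK : involutive inv_letter.
Proof. by case=> a b; rewrite /inv_letter /= negbK. Qed.

Lemma eq_inv_letter l l' : (l == inv_letter l') = (l' == inv_letter l).
Proof. by apply/eqP/eqP => ->; rewrite inv_letterK. Qed.

Lemma cons_red_reduced l s : reduced s -> reduced (cons_red l s).
Proof.
case: s => [|l' s] //= hs; case: ifPn => [_|ne]; first exact: path_sorted hs.
by rewrite /= ne.
Qed.

Lemma cat_red_reduced s t : reduced t -> reduced (cat_red s t).
Proof. by move=> ht; elim: s => //= l s IHs; exact: cons_red_reduced. Qed.

Lemma inv_word_reduced s : reduced s -> reduced (inv_word s).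
Proof.
rewrite /reduced /inv_word rev_sorted sorted_map.
apply: sub_sorted => l l' /=.
by rewrite (inj_eq (can_inj inv_letterK)) eq_inv_letter.
Qed.

Lemma cons_redK l s : reduced s -> cons_red (inv_letter l) (cons_red l s) = s.
Proof.
case: s => [|l1 s] /=; first by rewrite inv_letterK eqxx.
case: ifPn => [/eqP -> {l1}|_ _]; last by rewrite /= inv_letterK eqxx.
by case: s => [|l2 s] //= /andP[/negPf ->].
Qed.

Lemma cons_red_inv l s : reduced s -> cons_red l (cons_red (inv_letter l) s) = s.
Proof. by move=> hs; rewrite -{1}(inv_letterK l) cons_redK. Qed.

Lemma cat_cons_red l s t : reduced s -> reduced t ->
  cat_red (cons_red l s) t = cons_red l (cat_red s t).
Proof.
case: s => [|l' s] //= hs ht; case: eqP => [->|_] //.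
by rewrite cons_red_inv // cat_red_reduced.
Qed.

Lemma cat_redA s t u : reduced t -> reduced u ->
  cat_red s (cat_red t u) = cat_red (cat_red s t) u.
Proof.
move=> ht hu; elim: s => //= l s ->.
by rewrite cat_cons_red // cat_red_reduced.
Qed.

Lemma cat_red0 s : reduced s -> cat_red s [::] = s.
Proof.
elim: s => //= l s IHs hs; rewrite IHs; last exact: path_sorted hs.
by case: s hs {IHs} => [|l' s] //= /andP[/negPf ->].
Qed.

Lemma cat_red_invl s t : reduced t -> cat_red (inv_word s) (cat_red s t) = t.
Proof.
elim: s t => //= l s IHs t ht.
rewrite /inv_word /= rev_cons /cat_red foldr_rcons -/(cat_red s t).
by rewrite cons_redK ?cat_red_reduced // [LHS]IHs.
Qed.

Lemma inv_wordK : involutive inv_word.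
Proof.
by move=> s; rewrite /inv_word map_rev revK -map_comp map_id_in // => l _;
  exact: inv_letterK.
Qed.

Lemma word_reduced (x : free_group) : reduced (word x).
Proof. by case: x. Qed.

Definition fg_one := @FreeGroup [::] isT.
Definition fg_inv x := FreeGroup (inv_word_reduced (word_reduced x)).
Definition fg_mul x y := FreeGroup (cat_red_reduced (word x) (word_reduced y)).

Lemma fg_mulA : associative fg_mul.
Proof. by move=> x y z; apply/val_inj/cat_redA; exact: word_reduced. Qed.

Lemma fg_mul1 : left_id fg_one fg_mul.
Proof. by move=> x; exact: val_inj. Qed.

Lemma fg_mulr1 : right_id fg_one fg_mul.
Proof. by move=> x; apply/val_inj/cat_red0/word_reduced. Qed.

Lemma fg_mulV : left_inverse fg_one fg_inv fg_mul.
Proof.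
move=> x; apply: val_inj => /=.
by rewrite -{2}(cat_red0 (word_reduced x)) cat_red_invl.
Qed.

Lemma fg_mulVr : right_inverse fg_one fg_inv fg_mul.
Proof.
move=> x; apply: val_inj => /=; rewrite -{1}(inv_wordK (word x)).
by rewrite -{2}(cat_red0 (inv_word_reduced (word_reduced x))) cat_red_invl.
Qed.

HB.instance Definition _ := isGroup.Build free_group
  fg_mulA fg_mul1 fg_mulr1 fg_mulV fg_mulVr.

End FreeGroup.

HB.instance Definition _ (T : countType) :=
  [Countable of free_group T by <:].

Notation F2 := (free_group bool).

Definition polish (R : realType) (M : metricType R) : Prop :=
  (forall F : set_system M, ProperFilter F -> cauchy F ->
     exists x : M, F --> x) /\
  (exists2 D : set M, countable D & dense D).

Definition standard_borel (R : realType) (d : measure_display)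
    (X : measurableType d) : Prop :=
  exists (M : metricType R) (f : X -> M), [/\ polish M, bijective f &
    forall A : set M, <<s @open M >> A <-> measurable (f @^-1` A)].

Section Actions.
Context {G : groupType} {d : measure_display} {X : measurableType d}.
Context {R : realType}.
Implicit Types (act : G -> X -> X) (mu : probability X R) (k : nat).

(* G is meant to be countable and discrete, so measurability of the action map
   G * X -> X is measurability of each act g. *)
Definition borel_action act : Prop :=
  [/\ forall x, act 1%g x = x,
      forall g h x, act (g * h)%g x = act g (act h x) &
      forall g, measurable_fun [set: X] (act g)].

Definition mcp mu act : Prop :=
  forall (A : set X) (g : G), measurable A ->
    (mu A = 0%E <-> mu (act g @` A) = 0%E).

Definition chains_to mu act k (A B : set X) : Prop :=
  exists g : nat -> G,
    [/\ g 0%N = 1%g,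
        forall i, (i < k)%N ->
          (0 < mu ((act (g i) @` A) `&` (act (g i.+1) @` A)))%E &
        (0 < mu ((act (g k) @` A) `&` B))%E].

Definition chaining_on mu act k (W : set X) : Prop :=
  forall A B : set X, measurable A -> measurable B ->
    A `<=` W -> B `<=` W -> (0 < mu A)%E -> (0 < mu B)%E ->
    chains_to mu act k A B.

Definition chaining mu act k : Prop := chaining_on mu act k [set: X].

Definition boundedly_chaining mu act : Prop := exists k, chaining mu act k.

Definition generates (S : set G) : Prop :=
  forall H : {pred G}, group_closed H -> (forall g, S g -> g \in H) ->
    forall g, g \in H.

Definition essentially_chaining mu act k : Prop :=
  exists W : set X,
    [/\ measurable W,
        mu (~` \bigcup_g (act g @` W)) = 0%E,
        generates [set g | (0 < mu ((act g @` W) `&` W))%E] &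
        chaining_on mu act k W].

End Actions.

(* Main.v *)
From HB Require Import structures.
From mathcomp Require Import all_boot all_order all_algebra.
From mathcomp Require Import all_classical all_reals all_analysis.
From mathcomp Require Import measurable_realfun.
From mathcomp Require Import ring lra.
Require Import Defs.

(* Let a, b generate F_2 and let W be the set of infinite words in a^-1, b^-1
   with the fair coin measure, i.e. [0, 1) with Lebesgue measure via binary
   digits.  Let X be the F_2-orbit of W in the boundary of F_2, that is, the set
   of infinite reduced words that eventually contain only a^-1 and b^-1.

   A word in a^-1, b^-1 of length n maps W affinely onto a dyadic interval of
   length 2^-n.  If A is a subset of W of positive measure, choose by Lebesgue
   density such an interval gW that is almost filled by A; then g^-1 A almost
   fills W, hence meets A and any B given in advance: the action is 1-chaining
   on W.  Moreover aW and bW contain W, and the translates of W cover X.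

   On the other hand, if gW meets W then the reduced word of g is a product of
   inverse letters followed by a product of positive letters, so that g raises
   the number of maximal blocks of positive letters of any point by at most 1.
   As this number vanishes on W, it is at most k on the translates of W that
   can be reached from W in k steps, whereas every value is attained on a set of
   positive measure. *)

Set Implicit Arguments.
Unset Strict Implicit.
Unset Printing Implicit Defensive.
Import Order.TTheory GRing.Theory Num.Theory.
Import numFieldNormedType.Exports.
Local Open Scope classical_set_scope.
Local Open Scope ring_scope.

(** * Boundary words and the letters acting on them *)

Local Notation letter := (bool * bool)%type.
Implicit Types (l : letter) (s t : seq letter).


(* A point of X is the pair (s, v) of a reduced word s that is empty or ends in a
   positive letter and of v in [0, 1): it stands for the infinite word s c^-1 w,
   where w lists the inverse letters given by the binary digits of v; the letter
   c^-1 is present iff s is nonempty, and is then the inverse letter that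
   does not cancel the end of s. *)
Definition pos_ended s := reduced s && last true (map snd s).

(** A block of positive letters is counted at its last letter. The default [false] stands for the
    inverse letter that follows [s] in the infinite word. *)
Fixpoint runs s : nat :=
  if s is l :: s' then (l.2 && ~~ head false (map snd s') + runs s')%N else 0%N.

Definition neg_headed s := ~~ head false (map snd s).

Section Tree.
Variable R : realFieldType.
Implicit Types (v : R) (p : seq letter * R).

Definition head_digit v : bool := 2^-1 <= v.
Definition drop_digit v : R := 2 * v - (head_digit v)%:R.
Definition cons_digit (c : bool) v : R := (c%:R + v) / 2.

Definition frac v := 0 <= v < 1.

Lemma head_cons_digit c v : frac v -> head_digit (cons_digit c v) = c.
Proof.
rewrite /frac /head_digit /cons_digit.
by case: c => /= /andP[? ?]; apply/idP/idP => //; lra.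
Qed.

Lemma drop_cons_digit c v : frac v -> drop_digit (cons_digit c v) = v.
Proof. by move=> hv; rewrite /drop_digit head_cons_digit // /cons_digit; field. Qed.

Lemma cons_head_drop v : cons_digit (head_digit v) (drop_digit v) = v.
Proof. by rewrite /cons_digit /drop_digit; field. Qed.

Lemma frac_drop_digit v : frac v -> frac (drop_digit v).
Proof.
rewrite /frac /drop_digit /head_digit => /andP[? ?].
by case: (lerP 2^-1 v) => /= h; apply/andP; split; lra.
Qed.

Lemma frac_cons_digit c v : frac v -> frac (cons_digit c v).
Proof.
rewrite /frac /cons_digit => /andP[? ?].
by case: c => /=; apply/andP; split; lra.
Qed.

(** When a positive [l] leaves the root, the first digit becomes the implicit letter c^-1 and is
    dropped. When the only letter of [s] is cancelled, c^-1 turns into a digit again, c being the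
    generator other than [l.1]. *)
Definition step l p : seq letter * R :=
  if p.1 == [::] then
    if l.2 then (if head_digit p.2 == l.1 then [::] else [:: l], drop_digit p.2)
    else ([::], cons_digit l.1 p.2)
  else if p.1 == [:: inv_letter l] then ([::], cons_digit (~~ l.1) p.2)
  else (cons_red l p.1, p.2).

Definition tree p := pos_ended p.1 /\ frac p.2.

Lemma last_cons_red l s : s != [::] -> s != [:: inv_letter l] ->
  last true (map snd (cons_red l s)) = last true (map snd s).
Proof.
case: s => // l' [|l2 s] _ ne /=; last by case: eqP.
by case: eqP => // e; rewrite e eqxx in ne.
Qed.

Lemma step_cons_red l s v : s != [::] -> s != [:: inv_letter l] ->
  step l (s, v) = (cons_red l s, v).
Proof. by rewrite /step /= => /negbTE -> /negbTE ->. Qed.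

Lemma step_tree l p : tree p -> tree (step l p).
Proof.
case: p => s v [/= hs hv]; have [->|s0] := eqVneq s [::].
  rewrite /step /=; case: ifP => l2; split => //=; last exact: frac_cons_digit.
    by case: ifP => //= _; rewrite /pos_ended /= l2.
  exact: frac_drop_digit.
have [->|sl] := eqVneq s [:: inv_letter l].
  by rewrite /step /= eqxx; split => //; exact: frac_cons_digit.
rewrite step_cons_red //; split => //=; move: hs => /andP[hs ls].
by apply/andP; split; [exact: cons_red_reduced|rewrite last_cons_red].
Qed.

Lemma stepK l p : tree p -> step (inv_letter l) (step l p) = p.
Proof.
case: l p => a b [s v] [/= hs hv]; have [->|s0] := eqVneq s [::].
  rewrite /step /=; case: b => /=; last first.
    by rewrite head_cons_digit // eqxx /= drop_cons_digit.
  case: (head_digit v =P a) => [<-|] /=; first by rewrite cons_head_drop.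
  move=> h; rewrite eqxx -[in RHS](cons_head_drop v); congr (_, cons_digit _ _).
  by case: (a) (head_digit v) h => -[].
have [e|sl] := eqVneq s [:: inv_letter (a, b)].
  subst s; case: b hs {s0} => //= _; rewrite /step /= eqxx /=.
  by rewrite head_cons_digit // drop_cons_digit // /inv_letter /=; case: (a).
rewrite step_cons_red //; move: hs => /andP[hs _].
(* In the generic case this is [cons_redK], provided that the return step is generic too:
   [cons_red l s] is neither empty nor [[:: l]], since [s] is reduced, nonempty and not
   [[:: inv_letter l]]. *)
have cK := cons_redK (a, b) hs; rewrite -{2}cK.
case: s hs s0 sl {cK} => // l' s; set l := (a, b) => hs _ sl.
rewrite /cons_red; case: eqP => [e|_]; rewrite -/(cons_red _ _).
  rewrite step_cons_red //; first by apply: contraNneq sl => ->; rewrite e.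
  subst l'; case: s hs {sl} => //= l2 s /andP[l2n _].
  by apply: contra l2n => /eqP[-> _]; rewrite inv_letterK.
by rewrite step_cons_red // inv_letterK; apply/eqP => -[].
Qed.

Definition walk s p := foldr step p s.

Lemma walk_tree s p : tree p -> tree (walk s p).
Proof. by move=> hp; elim: s => //= l s; exact: step_tree. Qed.

Lemma walk_cat_red s t p : tree p ->
  walk (cat_red s t) p = walk s (walk t p).
Proof.
move=> hp; elim: s => //= l s <-.
case: (cat_red s t) => //= l' u; case: eqP => [->|//].
by rewrite -{1}(inv_letterK l) stepK //; exact: walk_tree.
Qed.

(** * Positive blocks along a walk *)

Lemma runs_step_neg l p : l.2 = false -> (runs (step l p).1 <= runs p.1)%N.
Proof.
case: l p => a b [s v] /= ->; have [->//|s0] := eqVneq s [::].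
have [->|sl] := eqVneq s [:: inv_letter (a, false)]; first by rewrite /step /= eqxx.
rewrite step_cons_red //; case: s {s0 sl} => //= l s.
by case: eqP => _ /=; [exact: leq_addl|].
Qed.

(** A positive letter opens a new block only in front of an inverse letter, and then the word no
    longer begins with one. The term [neg_headed] records whether this can still happen. *)
Lemma runs_step_pos l p : l.2 ->
  (runs (step l p).1 + neg_headed (step l p).1 <= runs p.1 + neg_headed p.1)%N.
Proof.
case: l p => a b [s v] /= ->; have [->|s0] := eqVneq s [::].
  by rewrite /step /=; case: ifP.
have [->|sl] := eqVneq s [:: inv_letter (a, true)]; first by rewrite /step /= eqxx.
rewrite step_cons_red //; case: s {s0 sl} => //= l s.
case: eqP => [->|_] /=; last by rewrite /neg_headed /= addn0 addnC.
by rewrite /neg_headed /= leq_add2l; case: (head _ _).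
Qed.

Lemma runs_walk_pos s p : all snd s ->
  (runs (walk s p).1 + neg_headed (walk s p).1 <= runs p.1 + neg_headed p.1)%N.
Proof.
by elim: s => //= l s IHs /andP[l2 /IHs]; apply: leq_trans; exact: runs_step_pos.
Qed.

(** Signs sorted by [implb] describe a product of inverse letters followed by a product of positive
    ones. *)
Lemma sorted_implb_cons l s :
  sorted implb (map snd (l :: s)) =
  (if l.2 then all snd s else sorted implb (map snd s)).
Proof.
elim: s l => [|l' s IHs] l /=; first by case: l.2.
by have /= -> := IHs l'; case: l.2; case: l'.2.
Qed.

(** The positive letters act first and together add at most 1, by the bound on [runs] plus
    [neg_headed]; the inverse letters then add nothing. *)
Lemma runs_walk_sorted s p : sorted implb (map snd s) ->
  (runs (walk s p).1 <= (runs p.1).+1)%N.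
Proof.
elim: s => [_|l s IHs]; first exact: leqnSn.
rewrite sorted_implb_cons; case: (boolP l.2) => [l2 hs|/negbTE l2 /IHs].
  have /(runs_walk_pos p) : all snd (l :: s) by rewrite /= l2.
  by move=> h; rewrite -addn1; apply: leq_trans (leq_trans h _);
    [exact: leq_addr|rewrite leq_add2l; case: neg_headed].
by apply: leq_trans; exact: runs_step_neg.
Qed.

(* Once a reduced word leaves the root it never comes back, since every further
   letter is prepended without cancellation. *)
Lemma walk_root s v : reduced s -> frac v ->
  let q := walk s ([::], v) in
  if q.1 == [::] then sorted implb (map snd s) /\
    (forall a s', s = (a, false) :: s' -> head_digit q.2 = a)
  else ohead q.1 = ohead s.
Proof.
move=> + hv; elim: s => //= l s IHs ls.
have {IHs} := IHs (path_sorted ls).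
have := @walk_tree s ([::], v) (conj isT hv).
case: (walk s _) => q w [/= _ hw].
have [->|q0] := eqVneq q [::] => /=; last first.
  case: q q0 => // l' q _; case: s ls => //= l2 s /andP[nl _] [->].
  rewrite step_cons_red //= ?(negbTE nl) //.
  by apply: contraNneq nl => -[->].
move=> [ss dg]; case: l ls => a [] ls; rewrite /step /=; last first.
  rewrite -[path _ _ _]/(sorted implb (map snd ((a, false) :: s))).
  by rewrite sorted_implb_cons ss; split => // a' s' [-> _]; rewrite head_cons_digit.
have [da|da] := eqVneq (head_digit w) a => //=.
rewrite -[path _ _ _]/(sorted implb (map snd ((a, true) :: s))) sorted_implb_cons /=.
(* If an inverse letter of index c came next, the clause on the head digit would make that digit c.
   Staying at the root requires it to be a, so a would cancel against its neighbour in a reduced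
   word. *)
split => //; case: s ls ss dg => // -[c []] s ls ss dg.
  by move: ss; rewrite sorted_implb_cons.
by move: ls; rewrite /= -da (dg c s) // eqxx.
Qed.

End Tree.

(** * Lebesgue measure on the real line *)

Lemma standard_borel_R (R : realType) : standard_borel R (measurableTypeR R).
Proof.
exists R^o, id; split; [split| |].
- move=> F FF /cauchy_cvg cF; exists (lim F); exact: cF.
- exists (@ratr R @` [set: rat]); last exact: dense_rat.
  exact: card_le_trans (card_image_le _ _) (countableP _).
- by exists id.
- move=> A; rewrite preimage_id; split.
    by move: A; apply: smallest_sub => [|A oA];
      [exact: sigma_algebra_measurable|exact: open_measurable].
  (* The measurable sets are generated by half-open intervals, hence also by open ones. *)
  change ((@ocitv R).-sigma.-measurable A -> <<s @open R^o >> A).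
  rewrite RGenOpens.measurableE.
  move: A; apply: smallest_sub; first exact: smallest_sigma_algebra.
  by move=> _ [x [y ->]]; apply: sub_sigma_algebra; exact: interval_open.
Qed.

Lemma measurable_affine (R : realType) (a b : R) :
  measurable_fun [set: measurableTypeR R] (fun x => a * x + b : measurableTypeR R).
Proof. by apply: measurable_funD => //; exact: measurable_funM. Qed.

(** By uniqueness of Lebesgue measure: a times its pushforward under the affine map gives every
    half-open interval its length. *)
Lemma lebesgue_measure_affine (R : realType) (a b : R)
    (A : set (measurableTypeR R)) :
  0 < a -> measurable A ->
  lebesgue_measure ((fun x => a * x + b) @^-1` A) = (a^-1%:E * lebesgue_measure A)%E.
Proof.
move=> a0 mA.
pose an : {nonneg R} := NngNum (ltW a0).
pose f (x : measurableTypeR R) : measurableTypeR R := a * x + b.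
suff -> : lebesgue_measure A = (a%:E * lebesgue_measure (f @^-1` A))%E.
  by rewrite muleA -EFinM mulVf ?gt_eqF // mul1e.
have mf : measurable_fun setT (f : _ -> measurableTypeR R) := measurable_affine a b.
have := @lebesgue_measure_unique R (mscale an (pushforward (@lebesgue_measure R) f)).
move/(_ mf); apply; last by [].
move=> _ [[c d] _ <-].
have pre : f @^-1` `]c, d] = `](c - b) / a, (d - b) / a]%classic.
  apply/seteqP; split => x;
  rewrite /f /= !in_itv /= ltr_pdivrMr // ler_pdivlMr // => /andP[? ?];
  by apply/andP; split; lra.
change (lebesgue_measure `]c, d] = a%:E * lebesgue_measure (f @^-1` `]c, d]))%E.
rewrite pre.
rewrite !lebesgue_measure_itv /= !lte_fin ltr_pM2r ?invr_gt0 // ltrD2r.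
case: ifP => _; last by rewrite mule0.
by rewrite -!EFinD -EFinM; congr (_%:E); field; rewrite gt_eqF.
Qed.

(** The normal density vanishes nowhere. The normal law thus serves as a probability in the class of
    Lebesgue measure, and positivity can be tested on the latter. *)
Lemma normal_prob_eq0 (R : realType) (A : set (measurableTypeR R)) :
  measurable A -> normal_prob 0 1 A = 0%E <-> lebesgue_measure A = 0%E.
Proof.
move=> mA; split; last first.
  exact: (null_content_dominatesP _ _).1 (@normal_prob_dominates R 0 1) _ mA.
rewrite /normal_prob => h.
have mf : measurable_fun A (EFin \o @normal_pdf R 0 1).
  by apply/measurable_EFinP/measurable_funTS; exact: measurable_normal_pdf.
have /(ae_eq_integral_abs lebesgue_measure mA mf) [N [mN N0 AN]] :
    (\int[lebesgue_measure]_(x in A) `|(EFin \o normal_pdf 0 1) x| = 0)%E.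
  rewrite -[RHS]h; apply: eq_integral => x _.
  by rewrite /= ger0_norm // normal_pdf_ge0.
apply: (subset_measure0 mA mN _ N0) => x Ax; apply: AN => /= /(_ Ax) [] /eqP.
rewrite normal_pdfE ?oner_eq0 // mulf_eq0 !gt_eqF ?expR_gt0 //.
by rewrite normal_peak_gt0 ?oner_eq0.
Qed.

Lemma exists_density_point (R : realType) (A : set (measurableTypeR R)) (e : R) :
  measurable A -> (0 < lebesgue_measure A)%E -> 0 < e ->
  exists2 x, A x & \forall h \near 0^'+,
    (lebesgue_measure (ball x h `\` A) <= (e * h)%:E)%E.
Proof.
move=> mA A0 e0; have [N [mN N0 AN]] := lebesgue_density mA.
have [x [Ax Nx]] : exists x, A x /\ ~ N x.
  apply: contrapT => h; move: A0; rewrite lt_neqAle eq_sym => /andP[/eqP + _]; apply.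
  apply: (subset_measure0 mA mN _ N0) => x Ax.
  by apply: contrapT => Nx; apply: h; exists x.
exists x => //.
have {Nx AN} : (lebesgue_measure (A `&` ball x r) * (lebesgue_measure (ball x r))^-1)%E
    @[r --> 0^'+] --> (\1_A x)%:E.
  by apply: contrapT => h; apply: Nx; apply: AN.
rewrite indicE mem_set //= => /fine_cvgP[fn].
(* The ball has length 2h, so a missing share below e/2 is a missing measure below eh. *)
move/cvgrPdist_lt => /(_ (e / 2)) /(_ (divr_gt0 e0 (ltr0Sn R 1))).
move=> he; near=> h.
have h0 : 0 < h by near: h; exact: nbhs_right_gt.
have mB : measurable (ball x h : set (measurableTypeR R)) by exact: measurable_ball.
have /= : `|1 - fine (lebesgue_measure (A `&` ball x h) /
    lebesgue_measure (ball x h))%E| < e / 2.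
  by near: h.
have Bh : lebesgue_measure (ball x h) = (h *+ 2)%:E.
  by rewrite lebesgue_measure_ball // ltW.
have Afin : lebesgue_measure (A `&` ball x h) \is a fin_num.
  rewrite ge0_fin_numE // (@le_lt_trans _ _ (h *+ 2)%:E) ?ltry // -Bh.
  by apply: le_measure; rewrite ?inE //; exact: measurableI.
have -> : (lebesgue_measure (ball x h `\` A) =
    (h *+ 2)%:E - lebesgue_measure (A `&` ball x h))%E.
  by rewrite measureD //= ?(setIC (ball x h)) Bh ?ltry.
rewrite Bh -(fineK Afin) inver mulrn_eq0 /= gt_eqF // -EFinM -EFinB lee_fin.
set m := fine (lebesgue_measure _) => /= hm.
have : 1 - m / (h *+ 2) < e / 2 by exact: le_lt_trans (ler_norm _) hm.
rewrite ltrBlDr -ltrBlDl ltr_pdivlMr ?mulrn_wgt0 // => h1.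
by rewrite lerBlDr; lra.
Unshelve. all: end_near. Qed.

Lemma bigcup_countType_null (R : realType) (I : countType)
    (F : I -> set (measurableTypeR R)) :
  (forall i, measurable (F i)) -> (forall i, lebesgue_measure (F i) = 0%E) ->
  lebesgue_measure (\bigcup_i F i) = 0%E.
Proof.
move=> mF F0; apply: measure_negligible.
  by apply: countable_bigcupT_measurable => //; exact: countableP.
pose G n := if unpickle n is Some i then F i else set0.
apply: (@negligibleS _ _ _ _ (\bigcup_n G n)).
  by move=> x [i _ Fx]; exists (pickle i) => //; rewrite /G pickleK.
apply: negligible_bigcup => n; rewrite /G; case: unpickle => [i|].
  exact: (negligibleP _ (mF i)).2 (F0 i).
exact: negligible_set0.
Qed.

(** * Maps that are affine on each of countably many pieces *)

Section PiecewiseAffine.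
Context (R : realType) (I : countType) (P : I -> set (measurableTypeR R)).
Context (f : measurableTypeR R -> measurableTypeR R).
Hypotheses (mP : forall i, measurable (P i)) (cover : \bigcup_i P i = [set: _])
  (fP : forall i, exists a b : R, 0 < a /\ forall x, P i x -> f x = a * x + b).

Let preimageE A : exists B : I -> set (measurableTypeR R),
  [/\ f @^-1` A = \bigcup_i B i,
      measurable A -> forall i, measurable (B i) &
      measurable A -> lebesgue_measure A = 0%E ->
        forall i, lebesgue_measure (B i) = 0%E].
Proof.
have [a /choice[b ab]] := choice fP.
exists (fun i => P i `&` (fun x => a i * x + b i) @^-1` A); split.
- apply/seteqP; split => [x Afx|x [i _ [Px /=]]]; last first.
    by rewrite /preimage /= (ab i).2.
  have [i _ Px] : (\bigcup_i P i) x by rewrite cover.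
  by exists i => //; split => //=; rewrite -(ab i).2.
- move=> mA i; apply: measurableI => //.
  by rewrite -[X in measurable X]setTI; exact: measurable_affine.
- move=> mA A0 i.
  have mB : measurable ((fun x => a i * x + b i) @^-1` A : set (measurableTypeR R)).
    by rewrite -[X in measurable X]setTI; exact: measurable_affine.
  apply: (subset_measure0 _ mB); [exact: measurableI|exact: subIsetr|].
  by rewrite [LHS]lebesgue_measure_affine ?A0 ?mule0 //; case: (ab i).
Qed.

Lemma measurable_piecewise_affine : measurable_fun [set: _] f.
Proof.
move=> _ A mA; rewrite setTI; have [B [-> mB _]] := preimageE A.
by apply: countable_bigcupT_measurable; [exact: countableP|exact: mB].
Qed.

Lemma preimage_piecewise_affine_null A : measurable A ->
  lebesgue_measure A = 0%E -> lebesgue_measure (f @^-1` A) = 0%E.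
Proof.
move=> mA A0; have [B [-> mB B0]] := preimageE A.
by apply: bigcup_countType_null; [exact: mB|exact: B0].
Qed.

End PiecewiseAffine.

HB.instance Definition _ := isPointed.Build int 0.

(** Both sets are countably infinite, the words because they include all powers of one generator.
    Words can therefore index the unit intervals between consecutive integers, which realises X as
    the real line. *)
Lemma pos_ended_int_bij : exists enc dec, [/\ forall n : int, pos_ended (dec n),
  cancel dec enc & forall s, pos_ended s -> dec (enc s) = s].
Proof.
have card_int : ([set: int] #= [set: nat])%card.
  apply: eq_card_nat; first exact: countableP.
  apply/infiniteP; rewrite -(card_le_eql (inj_card_eq (f := Posz) _)).
    exact: card_leT.
  by move=> ? ? _ _ [].
have card_words : ([set s | pos_ended s] #= [set: nat])%card.
  apply: eq_card_nat; first exact: countableP.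
  pose f n : seq letter := nseq n (true, true).
  apply/infiniteP; rewrite -(card_le_eql (inj_card_eq (f := f) _)).
    apply: subset_card_le => _ [n _ <-]; rewrite /= /pos_ended /reduced /f.
    apply/andP; split; first by case: n => //= n; elim: n.
    by rewrite map_nseq; elim: n => // -[].
  by move=> m n _ _ /(congr1 size); rewrite !size_nseq.
have /card_set_bijP[enc [encP injenc surj]] :
    ([set s | pos_ended s] #= [set: int])%card.
  by apply: card_eq_trans card_words _; rewrite card_eq_sym.
have /choice[dec decP] : forall n, exists s, pos_ended s /\ enc s = n.
  by move=> n; have [s sp <-] := surj n I; exists s.
exists enc, dec; split => [n|n|s sp]; [by case: (decP n)..|].
by apply: injenc; rewrite ?inE; case: (decP (enc s)).
Qed.

(** * The action on the real line *)

Definition fg_letter (l : letter) : F2 := FreeGroup (isT : reduced [:: l]).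

Lemma fg_ind (P : F2 -> Prop) : P 1%g ->
  (forall l g, P g -> P (fg_letter l * g)%g) -> forall g, P g.
Proof.
move=> P1 PM [s rs]; elim: s rs => [|l s IHs] rs.
  by rewrite (_ : FreeGroup _ = 1%g) //; exact: val_inj.
rewrite (_ : FreeGroup _ = fg_letter l * FreeGroup (path_sorted rs))%g.
  exact/PM/IHs.
apply: val_inj => /=; case: s rs {IHs} => //= l' s /andP[nl _].
by rewrite (negbTE nl).
Qed.

Lemma fg_letterV l : ((fg_letter l)^-1 = fg_letter (inv_letter l))%g.
Proof. exact: val_inj. Qed.

Section Action.
Variables (R : realType) (enc : seq letter -> int) (dec : int -> seq letter).
Hypotheses (dec_pos : forall n, pos_ended (dec n)) (decK : cancel dec enc)
  (encK : forall s, pos_ended s -> dec (enc s) = s).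
Implicit Types (x : measurableTypeR R) (p : seq letter * R).

(* The pair (s, v) is coded by the real number enc s + v. *)
Definition coords x : seq letter * R :=
  (dec (Num.floor x), x - (Num.floor x)%:~R).
Definition point p : measurableTypeR R := (enc p.1)%:~R + p.2.

Lemma frac_floor (x : R) : frac (x - (Num.floor x)%:~R).
Proof.
by have := floor_itv x; rewrite intrD /frac => /andP[? ?]; apply/andP; split; lra.
Qed.

Lemma coords_tree x : tree (coords x).
Proof. by split; [exact: dec_pos|exact: frac_floor]. Qed.

Lemma coordsK x : point (coords x) = x.
Proof. by rewrite /point /coords /= decK addrC subrK. Qed.

Lemma pointK p : tree p -> coords (point p) = p.
Proof.
case: p => s v [/= sp hv]; rewrite /coords /point /=.
have -> : Num.floor ((enc s)%:~R + v) = enc s.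
  apply: floor_def; move: hv; rewrite intrD /frac => /andP[? ?].
  by apply/andP; split; lra.
by rewrite encK // addrC addKr.
Qed.

Definition act (g : F2) x := point (walk (word g) (coords x)).

Lemma coords_act g x : coords (act g x) = walk (word g) (coords x).
Proof. by rewrite pointK //; apply: walk_tree; exact: coords_tree. Qed.

Lemma act1 x : act 1%g x = x.
Proof. exact: coordsK. Qed.

Lemma actM g h x : act (g * h)%g x = act g (act h x).
Proof.
by rewrite {1}/act /= walk_cat_red; [rewrite /act coords_act|exact: coords_tree].
Qed.

Lemma actK g : cancel (act g) (act g^-1%g).
Proof. by move=> x; rewrite -actM mulVg act1. Qed.

Lemma actVK g : cancel (act g^-1%g) (act g).
Proof. by move=> x; rewrite -actM mulgV act1. Qed.

Lemma image_act g (A : set (measurableTypeR R)) : act g @` A = act g^-1%g @^-1` A.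
Proof.
apply/seteqP; split => [_ [x Ax <-]|x Ax]; first by rewrite /preimage /= actK.
by exists (act g^-1%g x) => //; rewrite actVK.
Qed.

Definition piece (s : seq letter) : set (measurableTypeR R) :=
  [set x | (coords x).1 = s].

Lemma piece_itv s : pos_ended s ->
  piece s = `[(enc s)%:~R, (enc s)%:~R + 1[%classic.
Proof.
move=> sp; apply/seteqP; split => x; rewrite /piece /coords /= in_itv /=.
  by move=> <-; rewrite decK; have := floor_itv x; rewrite intrD.
move=> h; rewrite -(encK sp); congr dec; apply: floor_def.
by rewrite intrD.
Qed.

Lemma measurable_piece s : pos_ended s -> measurable (piece s).
Proof. by move=> sp; rewrite piece_itv. Qed.

Lemma lebesgue_measure_piece s : pos_ended s -> lebesgue_measure (piece s) = 1%E.
Proof.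
move=> sp; rewrite piece_itv // lebesgue_measure_itv /= lte_fin ltrDl ltr01.
by rewrite -EFinB; congr (_%:E); rewrite addrC addKr.
Qed.

(** At the root a positive letter reads the first digit, so the formula changes at 1/2; fixing the
    digit leaves slope 2, 1/2 or 1. *)
Lemma step_affine l s c : exists t a b, 0 < a /\
  forall v, head_digit v = c -> step l (s, v) = (t, a * v + b) :> (seq letter * R).
Proof.
have [->|s0] := eqVneq s [::].
  case: l => d [].
    exists (if c == d then [::] else [:: (d, true)]), 2, (- c%:R); split => // v dv.
    by rewrite /step /= /drop_digit dv.
  exists [::], 2^-1, (d%:R / 2); split => [|v _]; first by rewrite invr_gt0.
  by rewrite /step /= /cons_digit; congr pair; field.
have [->|sl] := eqVneq s [:: inv_letter l].
  exists [::], 2^-1, ((~~ l.1)%:R / 2); split => [|v _]; first by rewrite invr_gt0.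
  by rewrite /step /= eqxx /cons_digit; congr pair; field.
exists (cons_red l s), 1, 0; split => // v _.
by rewrite step_cons_red // mul1r addr0.
Qed.

Definition half_piece (i : int * bool) : set (measurableTypeR R) :=
  [set x | Num.floor x = i.1 /\ head_digit (x - (Num.floor x)%:~R) = i.2].

Lemma measurable_half_piece i : measurable (half_piece i).
Proof.
case: i => n c.
suff -> : half_piece (n, c) =
    `[n%:~R + c%:R / 2, n%:~R + (c%:R + 1) / 2[%classic by [].
apply/seteqP; split => x; rewrite /half_piece /head_digit /= in_itv /=.
  move=> [<- <-]; have := floor_itv x; rewrite intrD => /andP[? ?].
  by case: (lerP 2^-1 (x - _)) => /= ?; apply/andP; split; lra.
move=> /andP[h1 h2]; have xn : Num.floor x = n.
  by apply: floor_def; rewrite intrD; apply/andP; split; case: c h1 h2 => /=; lra.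
by rewrite xn; split => //; case: c h1 h2 => /= h1 h2; apply/idP/idP => //; lra.
Qed.

Lemma half_piece_cover : \bigcup_i half_piece i = [set: _].
Proof.
apply/seteqP; split => // x _.
by exists (Num.floor x, head_digit (x - (Num.floor x)%:~R)).
Qed.

Lemma act_letter_affine l i : exists a b : R, 0 < a /\
  forall x, half_piece i x -> act (fg_letter l) x = a * x + b.
Proof.
case: i => n c; have [t [a [b [a0 ab]]]] := step_affine l (dec n) c.
(* The image is [enc t] + a v + b with v = x - n. *)
exists a, ((enc t)%:~R + b - a * n%:~R); split => // x [/= xn dc].
by rewrite /act /= /coords xn ab /= -?xn // /point /=; ring.
Qed.

Lemma measurable_act g : measurable_fun [set: measurableTypeR R] (act g).
Proof.
elim/fg_ind: g => [|l g mg].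
  by rewrite (_ : act 1%g = id); [exact: measurable_id|exact/funext/act1].
rewrite (_ : act _ = act (fg_letter l) \o act g); last exact/funext/actM.
apply: measurableT_comp mg; apply: (measurable_piecewise_affine
  measurable_half_piece half_piece_cover); exact: act_letter_affine.
Qed.

Lemma measurable_preimage_act g A : measurable A -> measurable (act g @^-1` A).
Proof. by move=> mA; rewrite -[X in measurable X]setTI; exact: measurable_act. Qed.

Lemma measurable_image_act g A : measurable A -> measurable (act g @` A).
Proof. by move=> mA; rewrite image_act; exact: measurable_preimage_act. Qed.

Lemma preimage_act_null g A : measurable A -> lebesgue_measure A = 0%E ->
  lebesgue_measure (act g @^-1` A) = 0%E.
Proof.
elim/fg_ind: g A => [|l g IHg] A mA A0.
  by rewrite (_ : act 1%g = id) //; exact/funext/act1.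
rewrite (_ : act _ = act (fg_letter l) \o act g); last exact/funext/actM.
rewrite comp_preimage; apply: IHg; first exact: measurable_preimage_act.
exact: (preimage_piecewise_affine_null measurable_half_piece half_piece_cover
  (act_letter_affine l)).
Qed.

Lemma borel_action_act : borel_action act.
Proof. by split; [exact: act1|exact: actM|exact: measurable_act]. Qed.

Definition mu : probability (measurableTypeR R) R := normal_prob 0 1.

Lemma mu_gt0 A : measurable A -> (0 < mu A)%E = (0 < lebesgue_measure A)%E.
Proof.
move=> mA; rewrite !lt0e !measure_ge0 !andbT; congr (~~ _).
by apply/eqP/eqP => /(normal_prob_eq0 mA).
Qed.

Lemma mcp_act : mcp mu act.
Proof.
move=> A g mA; have mgA := measurable_image_act g mA.
split=> /(normal_prob_eq0 _) h; apply/(normal_prob_eq0 _) => //.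
  by rewrite image_act; apply: preimage_act_null => //; exact: h.
rewrite (_ : A = act g @^-1` (act g @` A)).
  by apply: preimage_act_null => //; exact: h.
by rewrite image_act; apply/seteqP; split => x; rewrite /preimage /= actK.
Qed.

End Action.

(** * Chaining *)

Section Chaining.
Variables (R : realType) (enc : seq letter -> int) (dec : int -> seq letter).
Hypotheses (dec_pos : forall n, pos_ended (dec n)) (decK : cancel dec enc)
  (encK : forall s, pos_ended s -> dec (enc s) = s).
Implicit Types (x : measurableTypeR R) (p : seq letter * R).
Local Notation coords := (@coords R dec).
Local Notation point := (@point R enc).
Local Notation act := (@act R enc dec).
Local Notation W := (@piece R dec [::]).
Local Notation actM := (actM dec_pos encK).
Local Notation mu := (mu R).

Lemma walk_cat s t (v : R) : t != [::] -> reduced (s ++ t) ->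
  walk s (t, v) = (s ++ t, v).
Proof.
move=> t0; elim: s => //= l s IHs rs; rewrite IHs; last exact: path_sorted rs.
case: (s ++ t) rs (size_cat s t) => [_ /esym/eqP|l' u /andP[nl _] _].
  by rewrite addn_eq0 !size_eq0 (negbTE t0) andbF.
rewrite step_cons_red //= ?(negbTE nl) //.
by apply: contraNneq nl => -[->].
Qed.

(** This makes the translates of W cover X. The preimage makes the implicit letter c^-1 the first
    digit; it differs from the last letter of [s], so nothing cancels. *)
Lemma walk_exit s (v : R) : pos_ended s -> frac v ->
  exists2 v', frac v' & walk s ([::], v') = (s, v).
Proof.
move=> sp hv; case/lastP: s sp => [|s [a b]]; first by exists v.
rewrite /pos_ended map_rcons last_rcons => /andP[rs /= bT].
rewrite {b}bT in rs *; exists (cons_digit (~~ a) v); first exact: frac_cons_digit.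
rewrite /walk foldr_rcons {2}/step /= head_cons_digit // drop_cons_digit //.
have -> : (~~ a == a) = false by case: (a).
by rewrite -cats1 in rs *; exact: walk_cat.
Qed.

Lemma piece0_act l : l.2 = false -> forall x, W x -> W (act (fg_letter l) x).
Proof.
case: l => a b /= -> x; rewrite /piece /mkset coords_act //.
by case: (coords x) => s v /= ->.
Qed.

Lemma generates_return : generates [set g | (0 < mu (act g @` W `&` W))%E].
Proof.
move=> H Hgrp HS; have [H1 _] := Hgrp.
have Hpos a : fg_letter (a, true) \in H.
  apply: HS => /=.
  have -> : act (fg_letter (a, true)) @` W `&` W = W.
    apply/seteqP; split => [x []//|x Wx]; split => //.
    by rewrite image_act // /preimage /= fg_letterV; exact: piece0_act.
  have mW : measurable W by exact: (measurable_piece decK encK).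
  by rewrite mu_gt0 // (lebesgue_measure_piece _ decK encK).
have Hl l : fg_letter l \in H.
  case: l => a []; first exact: Hpos.
  by rewrite -[(a, false)]/(inv_letter (a, true)) -fg_letterV; exact/group_closedV.
by move=> g; elim/fg_ind: g => // l g; apply: group_closedM.
Qed.

(** Here [g] spells the first n digits of [v] in inverse letters, and t is the left end of the
    dyadic interval of length 2^-n around [v]. *)
Lemma contraction n (v : R) : frac v -> exists g (t : R),
  [/\ t <= v < t + 2^-1 ^+ n, 0 <= t, t + 2^-1 ^+ n <= 1 &
    forall u, frac u -> act g (point ([::], u)) = point ([::], t + 2^-1 ^+ n * u)].
Proof.
elim: n v => [|n IHn] v hv.
  exists 1%g, 0; rewrite expr0 add0r; split => // u _.
  by rewrite act1 // add0r mul1r.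
have [g [t [/andP[t1 t2] t0 tn gt]]] := IHn _ (frac_drop_digit hv).
pose c := head_digit v; pose e : R := 2^-1 ^+ n.
have e0 : 0 < e by rewrite exprn_gt0.
exists (fg_letter (c, false) * g)%g, (cons_digit c t); rewrite exprS -/e.
have vE : v = cons_digit c (drop_digit v) by rewrite cons_head_drop.
rewrite -/e in t1 t2 tn gt; have c0 : (0 : R) <= c%:R by [].
have c1 : c%:R <= (1 : R) by rewrite lern1; case: (c).
split.
- by rewrite [X in _ <= X < _]vE /cons_digit; apply/andP; split; lra.
- by rewrite /cons_digit; lra.
- by rewrite /cons_digit; lra.
- move=> u hu; rewrite actM gt //.
  have hw : frac (t + e * u).
    move: hu; rewrite /frac => /andP[u0 u1].
    have : e * u < e by rewrite gtr_pMr.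
    have : 0 <= e * u by rewrite mulr_ge0 // ltW.
    by move=> ? ?; apply/andP; split; lra.
  rewrite /act pointK //; change (point ([::], cons_digit c (t + e * u)) =
    point ([::], cons_digit c t + 2^-1 * e * u)).
  by congr (point (_, _)); rewrite /cons_digit; field.
Qed.

Lemma chaining1_root : chaining_on mu act 1 W.
Proof.
move=> A B mA mB AW BW muA muB.
have [A0 B0] : (0 < lebesgue_measure A)%E /\ (0 < lebesgue_measure B)%E.
  by rewrite -!mu_gt0.
have mW : measurable W by exact: (measurable_piece decK encK).
have W1 : lebesgue_measure W = 1%E by exact: (lebesgue_measure_piece _ decK encK).
have fin (C : set (measurableTypeR R)) : measurable C -> C `<=` W ->
    lebesgue_measure C \is a fin_num.
  move=> mC CW; rewrite ge0_fin_numE // (@le_lt_trans _ _ 1%E) ?ltry // -W1.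
  by apply: le_measure; rewrite ?inE.
(* The part of W outside g^-1 A will have measure at most e, too little to contain almost all of A
   or of B. *)
pose e := Num.min (fine (lebesgue_measure A)) (fine (lebesgue_measure B)) / 2.
have e0 : 0 < e.
  rewrite divr_gt0 // lt_min -!lte_fin !fineK ?A0 ?B0 //; exact: fin.
have eA : (e%:E < lebesgue_measure A)%E.
  rewrite -(fineK (fin _ mA AW)) lte_fin /e ltr_pdivrMr //.
  have : Num.min (fine (lebesgue_measure A)) (fine (lebesgue_measure B)) <=
    fine (lebesgue_measure A) by rewrite ge_min lexx.
  by rewrite /e in e0; lra.
have eB : (e%:E < lebesgue_measure B)%E.
  rewrite -(fineK (fin _ mB BW)) lte_fin /e ltr_pdivrMr //.
  have : Num.min (fine (lebesgue_measure A)) (fine (lebesgue_measure B)) <=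
    fine (lebesgue_measure B) by rewrite ge_min lexx orbT.
  by rewrite /e in e0; lra.
have [x Ax near_x] := exists_density_point mA A0 e0.
have [n hn] : exists n,
    (lebesgue_measure (ball x (2^-1 ^+ n) `\` A) <= (e * 2^-1 ^+ n)%:E)%E.
  (* This n exceeds 1/d, and n < 2^n gives 2^-n < d. *)
  case: near_x => d /= d0 near_x; exists (Num.truncn d^-1).+1.
  apply: near_x; last by rewrite exprn_gt0.
  rewrite /= sub0r normrN gtr0_norm ?exprn_gt0 // exprVn invf_plt ?posrE ?exprn_gt0 //.
  apply: lt_trans (truncnS_gt _) _; rewrite -natrX ltr_nat; exact: ltn_expl.
have xW : x = point ([::], (coords x).2).
  by rewrite -[LHS](coordsK decK) (surjective_pairing (coords x)) (AW _ Ax).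
have [_ hv] := coords_tree dec_pos x.
have [g [t [/andP[t1 t2] _ _ gt]]] := contraction n hv.
set h : R := 2^-1 ^+ n in hn t2 gt.
have h0 : 0 < h by rewrite exprn_gt0.
have mgA := measurable_preimage_act dec_pos decK encK g mA.
have small : (lebesgue_measure (W `\` act g @^-1` A) <= e%:E)%E.
  (* In the real coordinate, g acts on W as y -> h y + b. *)
  pose b : R := (enc [::])%:~R + t - h * (enc [::])%:~R.
  pose D : set (measurableTypeR R) := ball x h `\` A.
  have mD : measurable D by apply: measurableD => //; exact: measurable_ball.
  (* The interval gW contains x and has length h, so it lies in [ball x h]. Pulling [D] back divides
     its measure by h, which turns the bound e h into e. *)
  have sub : W `\` act g @^-1` A `<=` (fun y => h * y + b) @^-1` D.
    move=> y [Wy Ay].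
    have yE : y = point ([::], (coords y).2).
      by rewrite -[LHS](coordsK decK) (surjective_pairing (coords y)) Wy.
    have [_ hy] := coords_tree dec_pos y.
    have gyE : act g y = h * y + b.
      by rewrite {1}yE gt // [in RHS]yE /point /b /=; ring.
    split; last by rewrite -gyE.
    rewrite -gyE {1}yE gt // [in X in ball X]xW /ball /= /point /=.
    rewrite opprD addrACA subrr add0r ltr_norml.
    move: hy; rewrite /frac => /andP[y0 y1].
    have hy0 : 0 <= h * (coords y).2 by rewrite mulr_ge0 // ltW.
    have hy1 : h * (coords y).2 < h by rewrite gtr_pMr.
    by rewrite /coords /= in t1 t2 hy0 hy1 *; apply/andP; split; lra.
  have mP : measurable ((fun y => h * y + b) @^-1` D : set (measurableTypeR R)).
    by rewrite -[X in measurable X]setTI; exact: measurable_affine.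
  apply: (@le_trans _ _ (lebesgue_measure ((fun y => h * y + b) @^-1` D))).
    by apply: le_measure; rewrite ?inE //; exact: measurableD.
  rewrite lebesgue_measure_affine // -(@lee_pmul2l _ h%:E) //.
  by rewrite muleA -EFinM mulfV ?gt_eqF // mul1e -EFinM mulrC.
have meets C : measurable C -> C `<=` W -> (e%:E < lebesgue_measure C)%E ->
    (0 < mu (act g^-1%g @` A `&` C))%E.
  move=> mC CW eC; rewrite image_act // invgK.
  have mI : measurable (act g @^-1` A `&` C) by exact: measurableI.
  rewrite mu_gt0 // lt0e measure_ge0 andbT; apply: contraTneq eC => I0.
  rewrite -leNgt; apply: le_trans small.
  rewrite (measureDI lebesgue_measure mC mgA) setIC [X in (_ + X)%E]I0 adde0.
  by apply: le_measure; rewrite ?inE; [exact: measurableD..|exact: setSD].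
exists (fun i => if i is 0%N then 1%g else g^-1%g); split => //=; last exact: meets.
case=> // _; rewrite setIC (_ : act 1%g @` A = A); first exact: meets.
by rewrite (_ : act 1%g = id) ?image_id //; apply/funext => y; exact: act1.
Qed.

Lemma essentially_chaining_act : essentially_chaining mu act 1.
Proof.
exists W; split.
- exact: (measurable_piece decK encK).
- rewrite (_ : \bigcup_g _ = setT) ?setCT ?measure0 //; apply/seteqP; split => // x _.
  have [sp hv] := coords_tree dec_pos x.
  have [v' hv' wE] := walk_exit sp hv.
  have [rs _] := andP sp.
  exists (FreeGroup rs) => //; exists (point ([::], v')).
    by rewrite /piece /mkset pointK.
  by rewrite /act /= pointK // wE -surjective_pairing coordsK.
- exact: generates_return.
- exact: chaining1_root.
Qed.

(** One point of W returning to W determines, by [walk_root], the shape of the word of g; the bound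
    then holds at every x, also outside W. *)
Lemma runs_act_return g x : (act g @` W `&` W) !=set0 ->
  (runs (coords (act g x)).1 <= (runs (coords x).1).+1)%N.
Proof.
case=> _ [[y Wy <-] Wgy]; rewrite coords_act //; apply: runs_walk_sorted.
have [_ hv] := coords_tree dec_pos y.
have := walk_root (word_reduced g) hv.
move: Wgy; rewrite /piece /mkset coords_act // (surjective_pairing (coords y)) Wy /=.
by move=> -> /= -[].
Qed.

(** The word (a b^-1)^k a, which has one positive block more than k steps from W can produce. *)
Fixpoint zigzag k : seq letter :=
  if k is k'.+1 then [:: (true, true), (false, false) & zigzag k']
  else [:: (true, true)].

Lemma zigzag_pos_ended k : pos_ended (zigzag k).
Proof. by elim: k => // -[|k]. Qed.

Lemma runs_zigzag k : runs (zigzag k) = k.+1.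
Proof. by elim: k => //= k ->. Qed.

Lemma measure_gt0_nonempty (A : set (measurableTypeR R)) : (0 < mu A)%E -> A !=set0.
Proof.
by move=> muA; apply/set0P; apply: contraTneq muA => ->; rewrite measure0 ltxx.
Qed.

Lemma not_boundedly_chaining_act : ~ boundedly_chaining mu act.
Proof.
case=> k /(_ W (@piece R dec (zigzag k))).
have mW : measurable W by exact: (measurable_piece decK encK).
have mZ : measurable (@piece R dec (zigzag k)).
  by apply: (measurable_piece decK encK); exact: zigzag_pos_ended.
move/(_ mW mZ (@subsetT _ _) (@subsetT _ _)).
rewrite !mu_gt0 // !(lebesgue_measure_piece _ decK encK) ?zigzag_pos_ended //.
move=> /(_ lte01 lte01) [g [g0 gS gk]].
have runs_g i : (i <= k)%N -> forall x,
    (runs (coords (act (g i) x)).1 <= runs (coords x).1 + i)%N.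
  elim: i => [_|i IHi ik] x; first by rewrite g0 act1 // addn0.
  (* Consecutive translates of W overlap, so g_i^-1 g_(i+1) returns a point of W to W. This factor
     acts before g_i, which is why the induction hypothesis is needed at all points. *)
  have /measure_gt0_nonempty[_ [[y Wy <-] [z Wz zy]]] := gS i ik.
  have -> : g i.+1 = (g i * ((g i)^-1 * g i.+1))%g by rewrite mulVKg.
  rewrite actM; apply: leq_trans (IHi (ltnW ik) _) _.
  rewrite addnS -addSn leq_add2r; apply: runs_act_return.
  exists y; split => //; exists z => //.
  by rewrite actM zy actK.
have /measure_gt0_nonempty[_ [[y Wy <-] Zy]] := gk.
have := runs_g k (leqnn k) y; rewrite Wy Zy runs_zigzag; by rewrite ltnn.
Qed.

End Chaining.

Theorem proposition6p13 (R : realType) :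
  exists (d : measure_display) (X : measurableType d) (mu : probability X R)
    (act : F2 -> X -> X),
    [/\ standard_borel R X, borel_action act, mcp mu act,
        essentially_chaining mu act 1 & ~ boundedly_chaining mu act].
Proof.
have [enc [dec [dec_pos decK encK]]] := pos_ended_int_bij.
exists _, (measurableTypeR R), (mu R), (@act R enc dec); split.
- exact: standard_borel_R.
- exact: borel_action_act.
- exact: mcp_act.
- exact: essentially_chaining_act.
- exact: not_boundedly_chaining_act.
Qed.
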